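(* Let $\Gamma=\langle\alpha,\beta\rangle$ be a numerical semigroup, with $\alpha<\beta$ coprime integers and $\alpha>2$. Then $|\mathsf{SG}\cup\mathsf{SSG}|\le|\mathcal{FG}(\Gamma)|$.
   Context: $\mathbb{N}$ contains $0$. $\Gamma=\langle\alpha,\beta\rangle=\{m\alpha+n\beta : m,n\in\mathbb{N}\}$; gaps are elements of $\mathbb{N}\setminus\Gamma$. Every gap $g$ has a unique expression $g=\alpha\beta-a\alpha-b\beta$ with integers $a,b\ge1$, and gaps are identified with the points of $LG=\{(a,b)\in\mathbb{Z}_{\ge1}^2: a\alpha+b\beta<\alpha\beta\}$ via $g\leftrightarrow(a,b)$. The set of fundamental gaps is $\mathcal{FG}(\Gamma)=\{g\in\mathbb{N}\setminus\Gamma:\{2g,3g\}\subset\Gamma\}$. $\mathcal{T}_u=\{(a,b)\in LG: b>\lfloor\alpha/2\rfloor\}$ and $\mathcal{T}_r=\{(a,b)\in LG: a>\lfloor\beta/2\rfloor\}$. The set of supersymmetric gaps is $\mathsf{SG}=\mathcal{T}_u$ if $|\mathcal{T}_u|<|\mathcal{T}_r|$ and $\mathsf{SG}=\mathcal{T}_r$ if $|\mathcal{T}_r|<|\mathcal{T}_u|$; if $|\mathcal{T}_u|=|\mathcal{T}_r|$, $\mathsf{SG}$ is either one of the two. A $\Gamma$-semimodule is a nonempty $\Delta\subseteq\mathbb{N}$ with $\Delta+\Gamma\subseteq\Delta$; its conductor is $c(\Delta)=\max(\mathbb{N}\setminus\Delta)+1$ (with $c(\mathbb{N})=0$) and $\delta(\Delta)=|\{x\in\Delta: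 x<c(\Delta)\}|$. For a gap $g$, let $\Delta_{[0,g]}=\Gamma\cup(\Gamma+g)$ and $W(g)=2\delta(\Delta_{[0,g]})-c(\Delta_{[0,g]})$. The set of self-symmetric gaps is $\mathsf{SSG}=\{g\in\mathbb{N}\setminus\Gamma: W(g)=0\}$. *)

(* Defs.v *)
From mathcomp Require Import all_boot all_order all_algebra finmap.
From mathcomp Require Import boolp classical_sets functions cardinality.

Set Implicit Arguments.
Unset Strict Implicit.
Unset Printing Implicit Defensive.

Import Order.TTheory GRing.Theory Num.Theory.

Local Open Scope classical_set_scope.
Local Open Scope nat_scope.

(* [fset_set] is junk (empty) on infinite sets; see [finite_gaps],
   [finite_LG] and [finite_gaps_semimodule2] for the finiteness facts. *)
Definition ncard (T : choiceType) (A : set T) : nat := #|` fset_set A|.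

Section TwoGenerated.
Variables alpha beta : nat.

Definition Gamma : set nat :=
  [set n | exists m k : nat, n = m * alpha + k * beta].

Definition gaps : set nat := ~` Gamma.

Definition LG : set (nat * nat) :=
  [set p | [/\ 1 <= p.1, 1 <= p.2
             & p.1 * alpha + p.2 * beta < alpha * beta]].

(* The subtraction is not truncated for [p] in [LG]. *)
Definition gap_of (p : nat * nat) : nat :=
  alpha * beta - p.1 * alpha - p.2 * beta.

Definition fundamental_gaps : set nat :=
  [set g | gaps g /\ [set 2 * g; 3 * g] `<=` Gamma].

Definition Tu : set (nat * nat) := [set p | LG p /\ alpha %/ 2 < p.2].
Definition Tr : set (nat * nat) := [set p | LG p /\ beta %/ 2 < p.1].

(* A relation, because either triangle is allowed in case of a tie. *)
Definition is_SG (S : set (nat * nat)) : Prop :=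
  [\/ ncard Tu < ncard Tr /\ S = Tu,
      ncard Tr < ncard Tu /\ S = Tr
    | ncard Tu = ncard Tr /\ (S = Tu \/ S = Tr)].

Definition is_semimodule (D : set nat) : Prop :=
  D !=set0 /\ [set x + y | x in D & y in Gamma] `<=` D.

(* The empty maximum is 0, which gives the convention c(N) = 0. *)
Definition conductor (D : set nat) : nat :=
  \max_(x <- fset_set (~` D)) x.+1.

Definition delta (D : set nat) : nat :=
  ncard [set x | D x /\ x < conductor D].

Definition semimodule2 (g : nat) : set nat :=
  Gamma `|` [set x + g | x in Gamma].

Definition W (g : nat) : int :=
  (2 * (delta (semimodule2 g))%:Z - (conductor (semimodule2 g))%:Z)%R.

Definition SSG : set nat := [set g | gaps g /\ W g = 0%R].

Lemma is_semimodule_semimodule2 g : is_semimodule (semimodule2 g).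
Proof.
have GD x y : Gamma x -> Gamma y -> Gamma (x + y).
  move=> [m [k ->]] [m' [k' ->]]; exists (m + m'), (k + k').
  by rewrite !mulnDl addnACA.
split; first by exists 0; left; exists 0, 0.
move=> _ [x [Gx|[z Gz <-]]] [y Gy <-]; first by left; apply: GD.
by right; exists (z + y); [apply: GD|rewrite addnAC].
Qed.

Lemma finite_LG : finite_set LG.
Proof.
apply: (@sub_finite_set _ _ (`I_beta `*` `I_alpha)); last first.
  by apply: finite_setX; apply: finite_II.
move=> [a b] [/= a1 b1 ltab].
have ab_gt0 : 0 < alpha * beta by apply: leq_ltn_trans ltab.
move: ab_gt0; rewrite muln_gt0 => /andP[al0 be0].
split => /=.
  rewrite -(ltn_pmul2r al0) [beta * _]mulnC.
  by apply: leq_ltn_trans ltab; rewrite leq_addr.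
rewrite -(ltn_pmul2r be0).
by apply: leq_ltn_trans ltab; rewrite leq_addl.
Qed.

Lemma finite_gaps : 0 < alpha -> coprime alpha beta -> finite_set gaps.
Proof.
move=> al0 cop.
apply: (@sub_finite_set _ _ `I_(alpha * beta)); last exact: finite_II.
move=> n nG /=; rewrite ltnNge; apply/negP => len; apply: nG.
pose c := chinese alpha beta n 0.
case: (posnP beta) => [b0|be0].
  move: cop; rewrite b0 /coprime gcdn0 => /eqP a1.
  by exists n, 0; rewrite a1 muln1 mul0n addn0.
have /dvdnP[q cE] : beta %| c.
  by rewrite /dvdn /c (chinese_modr cop) mod0n.
pose k := q %% alpha.
have kE : k * beta = n %[mod alpha].
  by rewrite modnMml -cE /c chinese_modl.
have lekn : k * beta <= n.
  by apply: leq_trans len; rewrite leq_mul2r ltnW ?orbT// ltn_mod.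
have /dvdnP[m mE] : alpha %| n - k * beta.
  by rewrite -eqn_mod_dvd //; apply/eqP.
by exists m, k; rewrite -mE subnK.
Qed.

Lemma finite_gaps_semimodule2 g :
  0 < alpha -> coprime alpha beta -> finite_set (~` semimodule2 g).
Proof.
move=> al0 cop; apply: (sub_finite_set _ (finite_gaps al0 cop)).
by apply: subsetC => x; left.
Qed.

End TwoGenerated.

(* Main.v *)
Require Import Defs.
From mathcomp Require Import all_boot all_order all_algebra finmap.
From mathcomp Require Import boolp classical_sets functions cardinality.
From mathcomp Require Import zify.

Local Open Scope classical_set_scope.
Local Open Scope nat_scope.

(** Write A and B for the two generators and read a gap as its lattice point
(a, b) in LG, so that the gap is A * B - a * A - b * B.

The self-symmetric gaps lie on a line.  Let g be the gap at (a, b).  Adding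
Gamma + g to Gamma fills exactly the a * b gaps of the rectangle
[1, a] x [1, b] ([setC_semimodule2_gap_of]), and the largest gap left is the
larger of those at (a + 1, 1) and (1, b + 1), which gives the conductor
(A - 1)(B - 1) - min (a * A, b * B) ([conductor_semimodule2]).  As Gamma has
(A - 1)(B - 1) / 2 gaps ([ncard_LG]), W g = 2 * a * b - min (a * A, b * B),
and its vanishing forces 2 * b = A or 2 * a = B ([SSG_half]).

The fundamental gaps contain, and in fact are, the L-shaped region of the
points with 2 * a <= B, 2 * b <= A, and 3 * a <= B or 3 * b <= A.

A closed half triangle fits into this L-shape.  If A <= 2 * b, then the
reflected point (a, A - b) satisfies 2 * a <= B and 2 * (A - b) <= A, so it
belongs to the L-shape unless 3 * a > B; in that case
it is lowered by A %/ 3, into the leg 3 * b <= A.  Whether a point is lowered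
depends on a alone and a is kept, so the map is injective
([ncard_upper_half]); exchanging the generators gives the same bound for the
half B <= 2 * a ([ncard_right_half]).

To conclude, A and B are not both even, so the self-symmetric gaps sit on a
single line: the lower edge b = A / 2 of the upper half if B is odd, the left
edge a = B / 2 of the right half if B is even.  The set SG has at most as many
points as either open triangle, so it can be traded for the triangle
adjacent to that line; their disjoint union is a closed half triangle. *)

(** * Cardinalities of finite sets *)

Lemma ncard_sub (T : choiceType) (X Y : set T) :
  finite_set Y -> X `<=` Y -> ncard X <= ncard Y.
Proof.
move=> fY XY; have fX := sub_finite_set XY fY.
by apply: fsubset_leq_card; rewrite -fset_set_sub.
Qed.

Lemma ncard_image_leq (T U : choiceType) (f : T -> U) (X : set T) :
  finite_set X -> ncard (f @` X) <= ncard X.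
Proof. by move=> fX; rewrite /ncard fset_set_image// leq_imfset_card. Qed.

Lemma ncard_image (T U : choiceType) (f : T -> U) (X : set T) :
  finite_set X -> (forall x y, X x -> X y -> f x = f y -> x = y) ->
  ncard (f @` X) = ncard X.
Proof.
move=> fX finj; rewrite /ncard fset_set_image// card_in_imfset// => x y /=.
by rewrite !in_fset_set// !inE; apply: finj.
Qed.

Lemma ncard_setU_leq (T : choiceType) (X Y : set T) :
  finite_set X -> finite_set Y -> ncard (X `|` Y) <= ncard X + ncard Y.
Proof.
by move=> fX fY; rewrite /ncard fset_setU// -cardfsUI leq_addr.
Qed.

Lemma ncard_setU (T : choiceType) (X Y : set T) :
  finite_set X -> finite_set Y -> (forall x, X x -> Y x -> False) ->
  ncard (X `|` Y) = ncard X + ncard Y.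
Proof.
move=> fX fY XY; rewrite /ncard fset_setU// -cardfsUI -fset_setI//.
suff -> : X `&` Y = set0 by rewrite fset_set0 cardfs0 addn0.
by rewrite -subset0 => x [] /XY.
Qed.

Lemma ncard_rect (m n : nat) :
  ncard [set p : nat * nat | 1 <= p.1 <= m /\ 1 <= p.2 <= n] = m * n.
Proof.
rewrite -{2}(card_ord m) -{2}(card_ord n) -card_prod -cardsT cardE.
pose f (p : 'I_m * 'I_n) := ((p.1 : nat).+1, (p.2 : nat).+1).
have finj : injective f.
  by move=> [i j] [i' j'] [] /val_inj -> /val_inj ->.
rewrite /ncard.
have -> : [set p : nat * nat | 1 <= p.1 <= m /\ 1 <= p.2 <= n] =
          [set` [fset f x | x in [set: 'I_m * 'I_n]%SET]%fset].
  apply/seteqP; split => -[x y] /=.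
    case: x => [|x]; case: y => [|y]; try by case.
    case=> /= xm yn; apply/imfsetP.
    by exists (Ordinal xm, Ordinal yn); rewrite ?inE.
  by case/imfsetP => -[i j] _ [-> ->] /=; rewrite !ltn_ord.
by rewrite set_fsetK card_imfset//= -cardE.
Qed.

(** * Gaps as lattice points *)

(** Modulo B the combination determines its first coefficient, and below A * B
that coefficient is smaller than B. *)
Lemma comb_inj (A B x y x' y' : nat) : coprime A B ->
  x * A + y * B = x' * A + y' * B -> x * A + y * B < A * B ->
  x = x' /\ y = y'.
Proof.
move=> cop; wlog le : x y x' y' / x' <= x.
  move=> H E L; case: (leqP x' x) => h; first exact: (H).
  by have [] := H _ _ _ _ (ltnW h) (esym E); [lia|move=> -> ->].
move=> E L.
have dvd : B %| x - x'.
  rewrite -(@Gauss_dvdl _ _ A) 1?coprime_sym//.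
  have -> : (x - x') * A = (y' - y) * B by nia.
  exact: dvdn_mull.
have xx' : x - x' = 0.
  apply/eqP; rewrite -leqn0 leqNgt; apply/negP => x0.
  have := dvdn_leq x0 dvd; nia.
have -> : x = x' by lia.
split => //; have {}xx' : x = x' by lia.
subst x'; nia.
Qed.

Lemma gap_ofE (A B : nat) (p : nat * nat) : LG A B p ->
  gap_of A B p + p.1 * A + p.2 * B = A * B.
Proof. by case=> _ _; rewrite /gap_of; lia. Qed.

Lemma gap_of_unique (A B n : nat) (p : nat * nat) :
  n + p.1 * A + p.2 * B = A * B -> n = gap_of A B p.
Proof. by rewrite /gap_of; lia. Qed.

Lemma gap_of_inj (A B : nat) (p q : nat * nat) : coprime A B ->
  LG A B p -> LG A B q -> gap_of A B p = gap_of A B q -> p = q.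
Proof.
move=> cop Lp Lq E; have Ep := gap_ofE _ _ _ Lp; have Eq := gap_ofE _ _ _ Lq.
have [||e1 e2] := @comb_inj A B p.1 p.2 q.1 q.2 cop; first lia.
  by case: Lp.
by rewrite (surjective_pairing p) (surjective_pairing q) e1 e2.
Qed.

(** Modulo B the coefficient x of such a combination vanishes; being positive
it is at least B, which leaves no room for y. *)
Lemma comb_mul_neq (A B x y : nat) : coprime A B -> 0 < x -> 0 < y ->
  x * A + y * B <> A * B.
Proof.
move=> cop x0 y0 E.
have dvd : B %| x.
  rewrite -(@Gauss_dvdl _ _ A) 1?coprime_sym//.
  have -> : x * A = (A - y) * B by nia.
  exact: dvdn_mull.
by have := dvdn_leq x0 dvd; nia.
Qed.

Lemma gaps_gap_of (A B : nat) (p : nat * nat) : coprime A B ->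
  LG A B p -> gaps A B (gap_of A B p).
Proof.
move=> cop Lp [m [k E]]; have := gap_ofE _ _ _ Lp; rewrite E.
case: Lp => p1 p2 L H.
by apply: (@comb_mul_neq A B (m + p.1) (k + p.2) cop); lia.
Qed.

(** Choose m < B with m * A congruent to g modulo B.  As g is a gap, m * A
exceeds g by a positive multiple k * B, and (B - m, k) is the point of g. *)
Lemma gaps_LG (A B g : nat) : 0 < A -> 0 < B -> coprime A B ->
  gaps A B g -> exists2 p, LG A B p & g = gap_of A B p.
Proof.
move=> A0 B0 cop Gg.
have g0 : 0 < g.
  by rewrite lt0n; apply/eqP => g0; apply: Gg; exists 0, 0; rewrite g0.
have cop' : coprime B A by rewrite coprime_sym.
pose c := chinese B A g 0.
have /dvdnP[q cE] : A %| c by rewrite /dvdn /c (chinese_modr cop') mod0n.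
pose m := q %% B.
have mB : m < B by rewrite ltn_mod.
have mE : m * A = g %[mod B] by rewrite modnMml -cE /c chinese_modl.
have gm : g < m * A.
  rewrite ltnNge; apply/negP => le; apply: Gg.
  have /dvdnP[k kE] : B %| g - m * A by rewrite -eqn_mod_dvd//; apply/eqP.
  by exists m, k; lia.
have /dvdnP[k kE] : B %| m * A - g.
  by rewrite -eqn_mod_dvd ?(ltnW gm)//; apply/eqP.
have k0 : 0 < k by nia.
have E : g + (B - m) * A + k * B = A * B by nia.
exists (B - m, k); last exact: gap_of_unique.
by split => /=; [lia|lia|lia].
Qed.

(** The half-turn s maps the open rectangle (0, B) x (0, A) to itself and
exchanges the two sides of its diagonal a * A + b * B = A * B, which
carries no lattice point by coprimality. *)
Lemma ncard_LG (A B : nat) : 0 < A -> 0 < B -> coprime A B ->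
  2 * ncard (LG A B) = A.-1 * B.-1.
Proof.
move=> A0 B0 cop.
pose s (p : nat * nat) := (B - p.1, A - p.2).
have LGlt p : LG A B p -> p.1 < B /\ p.2 < A by case=> *; nia.
rewrite [RHS]mulnC -(ncard_rect B.-1 A.-1).
have -> : [set p : nat * nat | 1 <= p.1 <= B.-1 /\ 1 <= p.2 <= A.-1] =
          LG A B `|` s @` LG A B.
  apply/seteqP; split => [[a b] [/= ha hb]|[a b] []].
  - have neq := @comb_mul_neq A B a b cop.
    case: (ltngtP (a * A + b * B) (A * B)) => h; last by case: neq; lia.
      by left; split => //=; lia.
    right; exists (B - a, A - b); last by rewrite /s /=; congr pair; lia.
    by split => /=; nia.
  - by move=> L; have := LGlt _ L; case: L => /= *; lia.
  - case=> -[x y] L; rewrite /s /= => -[<- <-]; have := LGlt _ L; case: L => /= *; lia.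
have fL := finite_LG A B.
rewrite ncard_setU//; last 2 first.
- exact: finite_image.
- move=> x Lx [p Lp spx]; have := LGlt _ Lp.
  by move: Lx; rewrite -spx => -[/= ? ? ?]; case: Lp => *; nia.
rewrite ncard_image ?mul2n ?addnn// => -[a b] [a' b'].
rewrite /s => /LGlt[/= a1 b1] /LGlt[/= a1' b1'] [ea eb].
by congr pair; lia.
Qed.

(** * The semimodule generated by 0 and a gap *)

(** If the gap at q lies in Gamma + g, uniqueness of coefficients below A * B
gives p = q + (m, k) with m and k natural numbers, where p is the point of g;
so the gaps filled by Gamma + g are those of the rectangle below p. *)
Lemma setC_semimodule2_gap_of (A B : nat) (p : nat * nat) :
  0 < A -> 0 < B -> coprime A B -> LG A B p ->
  ~` semimodule2 A B (gap_of A B p) =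
  gap_of A B @` (LG A B `\` [set q | 1 <= q.1 <= p.1 /\ 1 <= q.2 <= p.2]).
Proof.
move=> A0 B0 cop Lp; have Ep := gap_ofE _ _ _ Lp.
apply/seteqP; split => [x nx|_ [q [Lq nq] <-]].
  have [q Lq xq] : exists2 q, LG A B q & x = gap_of A B q.
    by apply: gaps_LG => // Gx; apply: nx; left.
  exists q => //; split => // -[/andP[q1 h1] /andP[q2 h2]].
  apply: nx; right; exists ((p.1 - q.1) * A + (p.2 - q.2) * B).
    by exists (p.1 - q.1), (p.2 - q.2).
  by have := gap_ofE _ _ _ Lq; rewrite -xq; nia.
case=> [|[_ [m [k ->]] E]]; first exact: gaps_gap_of.
have Eq := gap_ofE _ _ _ Lq.
have [||e1 e2] := @comb_inj A B p.1 p.2 (m + q.1) (k + q.2) cop; first lia.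
  by case: Lp.
by apply: nq; case: Lq => *; split; lia.
Qed.

Lemma ncard_setC_semimodule2 (A B : nat) (p : nat * nat) :
  0 < A -> 0 < B -> coprime A B -> LG A B p ->
  ncard (~` semimodule2 A B (gap_of A B p)) + p.1 * p.2 = ncard (LG A B).
Proof.
move=> A0 B0 cop Lp; rewrite setC_semimodule2_gap_of// -ncard_rect.
set R := [set q | _].
have RL : R `<=` LG A B.
  by case: Lp => ? ? ? q [/= /andP[? ?] /andP[? ?]]; split => //; nia.
have fL := finite_LG A B; have fR := sub_finite_set RL fL.
have fD : finite_set (LG A B `\` R) by exact: finite_setD.
rewrite ncard_image//; last by move=> x y [? _] [? _]; exact: gap_of_inj.
rewrite -ncard_setU//; last by move=> x [].
by congr ncard; rewrite setUC setDUK.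
Qed.

Lemma conductor_ge (D : set nat) (x : nat) :
  finite_set (~` D) -> ~ D x -> x < conductor D.
Proof.
move=> fD Dx; rewrite /conductor.
apply: (@leq_bigmax_seq _ _ xpredT (fun y => y.+1) x) => //.
by rewrite in_fset_set// inE.
Qed.

Lemma conductor_leq (D : set nat) (c : nat) :
  finite_set (~` D) -> (forall x, ~ D x -> x < c) -> conductor D <= c.
Proof.
move=> fD Dc; apply/bigmax_leqP_seq => x + _.
by rewrite in_fset_set// inE; exact: Dc.
Qed.

Lemma delta_conductor (D : set nat) :
  finite_set (~` D) -> delta D + ncard (~` D) = conductor D.
Proof.
move=> fD; set c := conductor D.
have fDc : finite_set [set x | D x /\ x < c].
  by apply: (@sub_finite_set _ _ `I_c) (finite_II c) => x [].
rewrite /delta -ncard_setU//; last by move=> x [].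
have -> : [set x | D x /\ x < c] `|` ~` D = `I_c.
  apply/seteqP; split => [x [[]//|/(conductor_ge _ _ fD)//]|x xc].
  by have [Dx|nDx] := pselect (D x); [left|right].
by rewrite /ncard (card_fset_set (card_eqxx _)).
Qed.

Lemma W_eq0 (A B g : nat) : finite_set (~` semimodule2 A B g) ->
  W A B g = 0%R ->
  conductor (semimodule2 A B g) = 2 * ncard (~` semimodule2 A B g).
Proof.
by move=> fD; rewrite /W; have := delta_conductor _ fD; lia.
Qed.

(** Outside the rectangle below p, the largest gap is at (p.1 + 1, 1) if
p.1 * A <= p.2 * B and at (1, p.2 + 1) otherwise.  That this point lies in LG
needs generators larger than 2: for A = 2 every gap may be filled and the
conductor drops to 0. *)
Lemma conductor_semimodule2 (A B : nat) (p : nat * nat) :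
  2 < A -> 2 < B -> coprime A B -> LG A B p ->
  conductor (semimodule2 A B (gap_of A B p)) + minn (p.1 * A) (p.2 * B) =
  A.-1 * B.-1.
Proof.
move=> A2 B2 cop Lp.
have A0 : 0 < A by lia. have B0 : 0 < B by lia.
have fD := finite_gaps_semimodule2 (gap_of A B p) A0 cop.
have Dgap q : LG A B q -> p.1 < q.1 \/ p.2 < q.2 ->
    ~ semimodule2 A B (gap_of A B p) (gap_of A B q).
  move=> Lq pq; rewrite -[~ _]/((~` semimodule2 _ _ _) _).
  by rewrite setC_semimodule2_gap_of//; exists q => //; split=> // -[]; lia.
have [N -> NE] : exists2 N, A.-1 * B.-1 = N & N + A + B = (A * B).+1.
  by exists (A.-1 * B.-1) => //; nia.
(* Both memberships in LG below reduce to 2 < (A - 2) * (B - 1) or its mirror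
   image, which among generators larger than 2 only fails for A = B = 3. *)
have nAB : A <> 3 \/ B <> 3.
  by case: (eqVneq A 3) => [eA|]; [right=> eB; move: cop; rewrite eA eB|lia].
have [q Lq [pq Eq]] : exists2 q, LG A B q & (p.1 < q.1 \/ p.2 < q.2) /\
    q.1 * A + q.2 * B = A + B + minn (p.1 * A) (p.2 * B).
  case: Lp => p1 p2 lt.
  case: (leqP (p.1 * A) (p.2 * B)) => le.
    have h1 : 2 * p.1 < B by nia.
    exists (p.1.+1, 1); last by split => /=; lia.
    by split => //=; nia.
  have h1 : 2 * p.2 < A by nia.
  exists (1, p.2.+1); last by split => /=; lia.
  by split => //=; nia.
have Eg := gap_ofE _ _ _ Lq.
apply/eqP; rewrite eqn_leq; apply/andP; split; last first.
  by have := conductor_ge _ _ fD (Dgap q Lq pq); lia.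
rewrite addnC -leq_subRL; last by lia.
apply: conductor_leq => // x /=.
rewrite -[~ _]/((~` semimodule2 _ _ _) _) setC_semimodule2_gap_of//.
case=> r [Lr /= nr] <-; have := gap_ofE _ _ _ Lr.
have : p.1 < r.1 \/ p.2 < r.2.
  have [h1|h1] := leqP r.1 p.1; last by left.
  right; rewrite ltnNge; apply/negP => h2; apply: nr.
  by case: Lr => r1 r2 _; split; apply/andP.
by case: Lr => *; nia.
Qed.

(** With m = min (p.1 * A, p.2 * B), the conductor formula and the count of gaps
turn W g = 0 into m = 2 * p.1 * p.2, and either value of m cancels to one of
the two equations. *)
Lemma SSG_half (A B g : nat) :
  2 < A -> 2 < B -> coprime A B -> SSG A B g ->
  exists2 p, LG A B p /\ (2 * p.1 = B \/ 2 * p.2 = A) & g = gap_of A B p.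
Proof.
move=> A2 B2 cop [Gg Wg].
have A0 : 0 < A by lia. have B0 : 0 < B by lia.
have [p Lp gp] := gaps_LG A B g A0 B0 cop Gg; exists p => //; split => //.
have fD := finite_gaps_semimodule2 g A0 cop.
have Dc := W_eq0 A B g fD Wg; rewrite gp in Dc.
have := conductor_semimodule2 A B p A2 B2 cop Lp.
have := ncard_setC_semimodule2 A B p A0 B0 cop Lp.
have := ncard_LG A B A0 B0 cop.
rewrite Dc => nLG nD cE.
have : minn (p.1 * A) (p.2 * B) = 2 * p.1 * p.2 by lia.
by case: Lp => p1 p2 _; case: leqP => _ H; [right|left]; nia.
Qed.

(** * The L-shaped region of fundamental gaps *)

Definition fundamental_LG (A B : nat) : set (nat * nat) :=
  [set p | LG A B p /\
           [/\ 2 * p.1 <= B, 2 * p.2 <= A & 3 * p.1 <= B \/ 3 * p.2 <= A]].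

(** Twice the gap at (a, b) is (B - 2 * a) * A + (A - 2 * b) * B.  Its triple is
3 * A * B - 3 * a * A - 3 * b * B, where one or two of the three copies of
A * B can be charged to the multiple of A; this is the alternative in the
definition. *)
Lemma fundamental_gaps_gap_of (A B : nat) (p : nat * nat) : coprime A B ->
  fundamental_LG A B p -> fundamental_gaps A B (gap_of A B p).
Proof.
move=> cop [Lp [p1 p2 p3]]; split; first exact: gaps_gap_of.
have E := gap_ofE _ _ _ Lp.
move=> _ [->|->]; first by exists (B - 2 * p.1), (A - 2 * p.2); nia.
case: p3 => p3.
  by exists (B - 3 * p.1), (2 * A - 3 * p.2); nia.
by exists (2 * B - 3 * p.1), (A - 3 * p.2); nia.
Qed.

Lemma ncard_fundamental_LG (A B : nat) : 0 < A -> coprime A B ->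
  ncard (fundamental_LG A B) <= ncard (fundamental_gaps A B).
Proof.
move=> A0 cop.
have fF : finite_set (fundamental_LG A B).
  by apply: (sub_finite_set _ (finite_LG A B)) => p [].
rewrite -(@ncard_image _ _ (gap_of A B)) //; last first.
  by move=> p q [Lp _] [Lq _]; exact: gap_of_inj.
apply: ncard_sub; last by move=> _ [p Fp <-]; exact: fundamental_gaps_gap_of.
by apply: (sub_finite_set _ (finite_gaps A0 cop)) => g [].
Qed.

(** The lowering step stays above 0 because 3 * a > B and
a * A < (A - b) * B force 3 * (A - b) > A; it ends in the leg 3 * b <= A
because A %/ 2 - A %/ 3 <= A %/ 3 as soon as 2 < A. *)
Lemma ncard_upper_half (A B : nat) : 2 < A ->
  ncard [set p | LG A B p /\ A <= 2 * p.2] <= ncard (fundamental_LG A B).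
Proof.
move=> A2; set U := [set p | _].
have fin X : X `<=` LG A B -> finite_set X.
  by move=> XL; apply: (sub_finite_set XL); exact: finite_LG.
have fU : finite_set U by apply: fin => p [].
pose f (p : nat * nat) :=
  (p.1, A - p.2 - (if 3 * p.1 <= B then 0 else A %/ 3)).
rewrite -(@ncard_image _ _ f)//; last first.
  move=> [a b] [a' b'] [[/= a1 b1 ab] b2] [[/= a1' b1' ab'] b2'].
  rewrite /f /= => -[aa' bb']; subst a'; congr pair.
  by move: bb'; case: leqP => h; nia.
apply: ncard_sub; first by apply: fin => p [].
move=> _ [[a b] [[/= a1 b1 ab] b2] <-]; rewrite /f /=.
case: leqP => h; do !split => /=; nia.
Qed.

Lemma ncard_swap (X : set (nat * nat)) : finite_set X ->
  ncard [set p | X (p.2, p.1)] = ncard X.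
Proof.
move=> fX; rewrite -(@ncard_image _ _ (fun p : nat * nat => (p.2, p.1)) X)//.
  by congr ncard; apply/seteqP; split => [[a b] /= Xp|_ [[a b] Xp <-]//];
    exists (b, a).
by move=> [a b] [a' b'] _ _ /= [-> ->].
Qed.

Lemma ncard_right_half (A B : nat) : 2 < B ->
  ncard [set p | LG A B p /\ B <= 2 * p.1] <= ncard (fundamental_LG A B).
Proof.
move=> B2; have := ncard_upper_half B A B2.
have fin X : X `<=` LG B A -> finite_set X.
  by move=> XL; apply: (sub_finite_set XL); exact: finite_LG.
have LGC a b : LG A B (a, b) <-> LG B A (b, a).
  by split; case=> /= *; split => /=; lia.
rewrite -(@ncard_swap [set p | LG B A p /\ _]); last by apply: fin => p [].
rewrite -(@ncard_swap (fundamental_LG B A)); last by apply: fin => p [].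
set X := [set p | _]; set Y := [set p | _] => XY.
set X' := [set p | _]; have -> : X' = X.
  by apply/seteqP; split => -[a b] [/LGC Lab le]; split.
have -> : fundamental_LG A B = Y; last exact: XY.
by apply/seteqP; split => -[a b] [/LGC Lab [? ? [?|?]]]; split => //; split;
  auto.
Qed.

(** * Counting supersymmetric and self-symmetric gaps together *)

Lemma ncard_SG (A B : nat) (S : set (nat * nat)) : is_SG A B S ->
  [/\ S `<=` LG A B, ncard S <= ncard (Tu A B) & ncard S <= ncard (Tr A B)].
Proof.
have uL : Tu A B `<=` LG A B by move=> p [].
have rL : Tr A B `<=` LG A B by move=> p [].
case=> [[/ltnW le ->]|[/ltnW le ->]|[e [|] ->]]; split => //.
- by rewrite e.
- by rewrite e.
Qed.

(** Only the size of S matters: S may be replaced by a set T at least as large,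
chosen disjoint from the line L that carries the self-symmetric gaps. *)
Lemma ncard_SG_SSG (A B : nat) (S T L : set (nat * nat)) :
  0 < A -> coprime A B -> S `<=` LG A B -> ncard S <= ncard T ->
  T `<=` LG A B -> L `<=` LG A B -> (forall p, T p -> L p -> False) ->
  SSG A B `<=` gap_of A B @` L ->
  ncard (T `|` L) <= ncard (fundamental_LG A B) ->
  ncard (gap_of A B @` S `|` SSG A B) <= ncard (fundamental_gaps A B).
Proof.
move=> A0 cop SL ST TL LL TL0 SSGL TLF.
apply: leq_trans (ncard_fundamental_LG A B A0 cop); apply: leq_trans TLF.
have fin X : X `<=` LG A B -> finite_set X.
  by move=> XL; apply: (sub_finite_set XL); exact: finite_LG.
have [fS fT fL] := And3 (fin _ SL) (fin _ TL) (fin _ LL).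
have fgL : finite_set (gap_of A B @` L) by exact: finite_image.
have fgS : finite_set (gap_of A B @` S) by exact: finite_image.
have fSSG := sub_finite_set SSGL fgL.
rewrite (@ncard_setU _ T L)//; apply: leq_trans (ncard_setU_leq _ _ _ fgS fSSG) _.
apply: leq_add; first exact: leq_trans (ncard_image_leq _ _ _ _ fS) ST.
by apply: leq_trans (ncard_sub _ _ _ fgL SSGL) _; exact: ncard_image_leq.
Qed.

Theorem proposition4p12 (alpha beta : nat) (SG : set (nat * nat))
    (halpha : 2 < alpha) (hlt : alpha < beta) (hcop : coprime alpha beta)
    (hSG : is_SG alpha beta SG) :
  ncard ((gap_of alpha beta @` SG) `|` SSG alpha beta)
    <= ncard (fundamental_gaps alpha beta).
Proof.
have alpha0 : 0 < alpha by lia.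
have hbeta : 2 < beta by lia.
have [SGL SGu SGr] := ncard_SG _ _ _ hSG.
have TuL : Tu alpha beta `<=` LG alpha beta by move=> p [].
have TrL : Tr alpha beta `<=` LG alpha beta by move=> p [].
have fin X : X `<=` LG alpha beta -> finite_set X.
  by move=> XL; apply: (sub_finite_set XL); exact: finite_LG.
case: (boolP (odd beta)) => beta2.
- pose L := [set p | LG alpha beta p /\ 2 * p.2 = alpha].
  apply: (@ncard_SG_SSG _ _ SG (Tu alpha beta) L) => //; first by move=> p [].
  + by move=> p [_ pu] [_ pL]; lia.
  + by move=> g /SSG_half[]// p [Lp [e|e]] ->; [lia|exists p].
  + apply: leq_trans (ncard_upper_half _ _ halpha).
    apply: ncard_sub; first by apply: fin => p [].
    by move=> p [[Lp pu]|[Lp pL]]; split => //; lia.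
- pose L := [set p | LG alpha beta p /\ 2 * p.1 = beta].
  apply: (@ncard_SG_SSG _ _ SG (Tr alpha beta) L) => //; first by move=> p [].
  + by move=> p [_ pr] [_ pL]; lia.
  + move=> g /SSG_half[]// p [Lp [e|e]] ->; first by exists p.
    (* A point with 2 * p.2 = alpha would make both generators even. *)
    have : 2 %| gcdn alpha beta by rewrite dvdn_gcd; lia.
    by rewrite (eqP hcop).
  + apply: leq_trans (ncard_right_half _ _ hbeta).
    apply: ncard_sub; first by apply: fin => p [].
    by move=> p [[Lp pr]|[Lp pL]]; split => //; lia.
Qed.
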